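(* Let $\Gamma=A*_\phi$ with $\phi:C_{-1}\to C_{+1}$ be an HNN extension. Let $\gamma,\gamma'$ be cyclically reduced elements of $\Gamma$ conjugate by $h\in\Gamma$, i.e. $\gamma=h\gamma'h^{-1}$. Then $\gamma$ and $\gamma'$ have the same length, and moreover: (i) If $\gamma$ is conjugate to an element of $C_{+1}\cup C_{-1}$, then $\gamma,\gamma'\in A$, and if $h$ is written in reduced form $h=h_1t^{\varepsilon_1}\cdots t^{\varepsilon_p}h_{p+1}$, there is a finite sequence $(c_0,c_1,\dots,c_{2p-1})$ of elements of $C_{+1}\cup C_{-1}$ such that, putting $c_{2p}=\gamma'$, one has $\gamma=h_1c_0h_1^{-1}$ and, for $i=0,\dots,p-1$, $$c_{2i+1}=h_{i+2}\,c_{2i+2}\,h_{i+2}^{-1},\qquad c_{2i}=t^{\varepsilon_{i+1}}\,c_{2i+1}\,t^{-\varepsilon_{i+1}}.$$ (ii) If $\gamma\in A$ and $\gamma$ is not conjugate to an element of $C_{+1}\cup C_{-1}$, then $\gamma'\in A$ and $\gamma,\gamma'$ are conjugate by $h$ in $A$ (that is, $h\in A$). (iii) If $\gamma\notin A$, with $\gamma=u_1t^{\mu_1}\cdots u_mt^{\mu_m}$ and $\gamma'=v_1t^{\nu_1}\cdots v_mt^{\nu_m}$ cyclically reduced forms, $m\ge1$, then $\gamma$ is obtained by conjugating a cyclic conjugate $$v_rt^{\nu_r}\cdots v_mt^{\nu_m}v_1t^{\nu_1}\cdots v_{r-1}t^{\nu_{r-1}}$$ of $\gamma'$ by an element $\alpha$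 of $C_{\mu_m}$.
   Context: Let $A$ be a group, $C_{-1},C_{+1}$ subgroups of $A$ and $\phi:C_{-1}\to C_{+1}$ an isomorphism. The HNN extension is $A*_\phi=\langle A,t\mid t^{-1}ct=\phi(c)\ \forall c\in C_{-1}\rangle$, and $A$ is identified with its (injective) image. A pinch is a word $t^{\varepsilon}ct^{-\varepsilon}$ with $\varepsilon=\pm1$, $c\in C_\varepsilon$. Every $g\in A*_\phi$ has a reduced form $g=g_1t^{\varepsilon_1}g_2\cdots t^{\varepsilon_n}g_{n+1}$, $n\geq 0$, with $g_i\in A$, $\varepsilon_i=\pm1$, containing no pinch; the length is $|g|=n+1$ (independent of the form), so $|g|=1$ iff $g\in A$. An element $g$ is cyclically reduced if $|g|=1$, or if it has a reduced form $g=g_1t^{\varepsilon_1}g_2\cdots t^{\varepsilon_n}g_{n+1}$ (with $g_i\in A$, $\varepsilon_i=\pm1$, containing no pinch) with $g_{n+1}=1$ and either $|g|=2$, or $|g|>2$ and $t^{\varepsilon_n}g_1t^{\varepsilon_1}$ is not a pinch; such a form $g_1t^{\varepsilon_1}\cdots g_nt^{\varepsilon_n}$ is called a cyclically reduced form. Its cyclic conjugates are the elements $g_rt^{\varepsilon_r}\cdots g_nt^{\varepsilon_n}g_1t^{\varepsilon_1}\cdots g_{r-1}t^{\varepsilon_{r-1}}$, $1\le r\le n$ (for $r=1$ this is $g$ itself). Without further specification, conjugate means conjugate in $\Gamma$. *)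

(* Defs.v *)
From HB Require Import structures.
From mathcomp Require Import all_boot.
From mathcomp Require Import boolp classical_sets.

Set Implicit Arguments.
Unset Strict Implicit.
Unset Printing Implicit Defensive.

Local Open Scope group_scope.
Local Open Scope quotient_scope.

(* Signs +1 and -1 are encoded by the booleans true and false, so that [~~ e]
   is the opposite of the sign e.  The isomorphism phi : C_{-1} -> C_{+1} is
   the restriction to [assoc false] of a function on A, whose values outside
   [assoc false] are never used. *)
Record hnn_datum (A : groupType) := HNNDatum {
  assoc : bool -> groupClosed A;
  phi : A -> A;
  phiM : {in assoc false &, {morph phi : x y / x * y}};
  phi_inj : {in assoc false &, injective phi};
  phi_img : forall y : A,
    y \in assoc true <-> exists2 x, x \in assoc false & y = phi x
}.

Section Hnn.
Variables (A : groupType) (D : hnn_datum A).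

(* Words in A and the letters t (inr true) and t^-1 (inr false). *)
Definition hnn_word := seq (A + bool).

(* The congruence on words whose quotient is the group with presentation
   < A, t | t^-1 c t = phi c for c in C_{-1} >. *)
Inductive hnn_cong : hnn_word -> hnn_word -> Prop :=
| hnn_refl u : hnn_cong u u
| hnn_sym u v : hnn_cong u v -> hnn_cong v u
| hnn_trans u v w : hnn_cong u v -> hnn_cong v w -> hnn_cong u w
| hnn_cat u u' v v' :
    hnn_cong u u' -> hnn_cong v v' -> hnn_cong (u ++ v) (u' ++ v')
| hnn_one : hnn_cong [:: inl 1] [::]
| hnn_mul a b : hnn_cong [:: inl a; inl b] [:: inl (a * b)]
| hnn_tt e : hnn_cong [:: inr e; inr (~~ e)] [::]
| hnn_phi c : c \in assoc D false ->
    hnn_cong [:: inr false; inl c; inr true] [:: inl (phi D c)].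

Definition hnn_rel : rel hnn_word := fun u v => `[< hnn_cong u v >].

Lemma hnn_rel_refl : reflexive hnn_rel.
Proof. by move=> u; apply/asboolP; exact: hnn_refl. Qed.

Lemma hnn_rel_sym : symmetric hnn_rel.
Proof. by move=> u v; apply/asboolP/asboolP; exact: hnn_sym. Qed.

Lemma hnn_rel_trans : transitive hnn_rel.
Proof.
move=> v u w /asboolP uv /asboolP vw; apply/asboolP; exact: hnn_trans uv vw.
Qed.

Canonical hnn_equiv := EquivRel hnn_rel hnn_rel_refl hnn_rel_sym hnn_rel_trans.

(* The HNN extension A*_phi. *)
Definition hnn := {eq_quot hnn_equiv}.

HB.instance Definition _ := Choice.on hnn.
HB.instance Definition _ := EqQuotient.on hnn.

Lemma hnn_piP u v : \pi_hnn u = \pi_hnn v <-> hnn_cong u v.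
Proof. by split=> [/eqmodP/asboolP|uv] //; apply/eqmodP/asboolP. Qed.

Lemma hnn_repr u : hnn_cong (repr (\pi_hnn u)) u.
Proof. by apply/hnn_piP; rewrite reprK. Qed.

Definition hnn_inv_letter (x : A + bool) : A + bool :=
  match x with inl a => inl a^-1 | inr e => inr (~~ e) end.

Definition hnn_inv_word (u : hnn_word) : hnn_word :=
  rev (map hnn_inv_letter u).

Lemma hnn_mulVw u : hnn_cong (hnn_inv_word u ++ u) [::].
Proof.
elim: u => [|x u IHu]; first exact: hnn_refl.
rewrite /hnn_inv_word /= rev_cons cat_rcons -cat1s -(cat1s x u) (catA [:: _]).
apply: hnn_trans IHu; apply: hnn_cat; first exact: hnn_refl.
rewrite -[X in hnn_cong _ X]cat0s; apply: hnn_cat; last exact: hnn_refl.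
case: x => [a|e] /=; last by rewrite -{2}[e]negbK; exact: hnn_tt.
by apply: hnn_trans (hnn_mul _ _) _; rewrite mulVg; exact: hnn_one.
Qed.

Lemma hnn_inv_wordK : involutive hnn_inv_word.
Proof.
move=> u; rewrite /hnn_inv_word map_rev revK -map_comp map_id_in // => -[a|e] _ /=.
  by rewrite invgK.
by rewrite negbK.
Qed.

Definition hnn_mulg (x y : hnn) : hnn := \pi_hnn (repr x ++ repr y).
Definition hnn_invg (x : hnn) : hnn := \pi_hnn (hnn_inv_word (repr x)).

Lemma hnn_pi_cat u v : hnn_mulg (\pi_hnn u) (\pi_hnn v) = \pi_hnn (u ++ v).
Proof. by apply/hnn_piP; apply: hnn_cat; exact: hnn_repr. Qed.

Lemma hnn_mulgA : associative hnn_mulg.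
Proof.
elim/quotW=> u; elim/quotW=> v; elim/quotW=> w.
by rewrite (hnn_pi_cat v) (hnn_pi_cat u) (hnn_pi_cat u v) hnn_pi_cat catA.
Qed.

Lemma hnn_mul1g : left_id (\pi_hnn [::]) hnn_mulg.
Proof. by elim/quotW=> u; rewrite (hnn_pi_cat [::] u). Qed.

Lemma hnn_mulg1 : right_id (\pi_hnn [::]) hnn_mulg.
Proof. by elim/quotW=> u; rewrite (hnn_pi_cat u [::]) cats0. Qed.

Lemma hnn_mulVg : left_inverse (\pi_hnn [::]) hnn_invg hnn_mulg.
Proof.
move=> x; rewrite -{2}[x]reprK /hnn_invg hnn_pi_cat; apply/hnn_piP.
exact: hnn_mulVw.
Qed.

Lemma hnn_mulgV : right_inverse (\pi_hnn [::]) hnn_invg hnn_mulg.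
Proof.
move=> x; rewrite -{1}[x]reprK /hnn_invg hnn_pi_cat; apply/hnn_piP.
by rewrite -{1}[repr x]hnn_inv_wordK; exact: hnn_mulVw.
Qed.

HB.instance Definition _ := isMonoid.Build hnn hnn_mulgA hnn_mul1g hnn_mulg1.
HB.instance Definition _ := hasInv.Build hnn hnn_invg.
HB.instance Definition _ := Monoid_isGroup.Build hnn hnn_mulVg hnn_mulgV.

(* The canonical map A -> A*_phi and the stable letter. *)
Definition hnn_emb (a : A) : hnn := \pi_hnn [:: inl a].
Definition hnn_t : hnn := \pi_hnn [:: inr true].

Lemma hnn_embM : {morph hnn_emb : a b / a * b}.
Proof. by move=> a b; rewrite [RHS]hnn_pi_cat; apply/esym/hnn_piP/hnn_mul. Qed.

HB.instance Definition _ := isMultiplicative.Build A hnn hnn_emb hnn_embM.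

Lemma hnn_emb1 : hnn_emb 1 = 1.
Proof. by apply/hnn_piP; exact: hnn_one. Qed.

HB.instance Definition _ :=
  Multiplicative_isUMagmaMorphism.Build A hnn hnn_emb hnn_emb1.

Definition hnn_tpow (e : bool) : hnn := if e then hnn_t else hnn_t^-1.

Lemma hnn_pi_t e : \pi_hnn [:: inr e] = hnn_tpow e.
Proof.
case: e => //=; apply/(mulIg hnn_t); rewrite mulVg [LHS]hnn_pi_cat.
by apply/hnn_piP; exact: (hnn_tt false).
Qed.

Lemma hnn_conj_t c : c \in assoc D false ->
  hnn_t^-1 * hnn_emb c * hnn_t = hnn_emb (phi D c).
Proof.
move=> Cc; have -> : hnn_t^-1 = \pi_hnn [:: inr false] by rewrite hnn_pi_t.
rewrite [_ * hnn_emb _](hnn_pi_cat [:: _] [:: _]) [LHS](hnn_pi_cat _ [:: _]).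
by apply/hnn_piP; exact: hnn_phi.
Qed.

Lemma hnn_universal (H : groupType) (f : UMagmaMorphism.type A H) (s : H) :
  (forall c, c \in assoc D false -> s^-1 * f c * s = f (phi D c)) ->
  exists g : hnn -> H,
    [/\ {morph g : x y / x * y}, (forall a, g (hnn_emb a) = f a)
      & g hnn_t = s].
Proof.
move=> fs; pose l (x : A + bool) :=
  match x with inl a => f a | inr e => if e then s else s^-1 end.
pose G (u : hnn_word) := \prod_(x <- u) l x.
have Geq u v : hnn_cong u v -> G u = G v.
  elim=> {u v} //.
  - by move=> u v w _ -> _ ->.
  - by move=> u u' v v' _ + _; rewrite /G !big_cat /= => -> ->.
  - by rewrite /G big_seq1 big_nil /= gmulf1.
  - by move=> a b; rewrite /G !big_cons big_nil /= mulg1 gmulfM mulg1.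
  - by move=> [] /=; rewrite /G !big_cons big_nil /= mulg1 ?mulgV ?mulVg.
  - by move=> c Cc; rewrite /G !big_cons !big_nil /= !mulg1 mulgA fs.
exists (fun x => G (repr x)); split=> [x y|a|].
- by rewrite (Geq _ _ (hnn_repr _)) /G big_cat.
- by rewrite (Geq _ _ (hnn_repr _)) /G big_seq1.
by rewrite (Geq _ _ (hnn_repr _)) /G big_seq1.
Qed.

(* x lies in the copy of A inside A*_phi. *)
Definition in_base (x : hnn) : Prop := exists a : A, x = hnn_emb a.

(* x is conjugate to an element of C_{+1} \cup C_{-1}. *)
Definition conj_to_assoc (x : hnn) : Prop :=
  exists (g : hnn) (e : bool) (c : A),
    c \in assoc D e /\ x = g * hnn_emb c * g^-1.

(* The form g_1 t^{e_1} ... g_n t^{e_n} g_{n+1} is represented by the sequence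
   [:: (g_1, e_1); ...; (g_n, e_n)] together with g_{n+1}. *)
Definition hnn_eval (s : seq (A * bool)) (a : A) : hnn :=
  (\prod_(p <- s) (hnn_emb p.1 * hnn_tpow p.2)) * hnn_emb a.

(* t^e g t^e' is a pinch. *)
Definition pinch (e : bool) (g : A) (e' : bool) : bool :=
  (e' == ~~ e) && (g \in assoc D e).

(* No t^{e_i} g_{i+1} t^{e_{i+1}}, 1 <= i < n, is a pinch. *)
Definition reduced (s : seq (A * bool)) : bool :=
  sorted (fun p q => ~~ pinch p.2 q.1 q.2) s.

Definition reduced_form (x : hnn) (s : seq (A * bool)) (a : A) : Prop :=
  reduced s /\ x = hnn_eval s a.

(* The length n + 1, read off a chosen reduced form. *)
Definition hnn_length (x : hnn) : nat :=
  (size (xget ([::], 1) [set f | reduced_form x f.1 f.2]).1).+1.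

(* Here the length n + 1 of the form is (size s).+1, so that length 2 means
   that s has exactly one entry. *)
Definition cyc_reduced_form (x : hnn) (s : seq (A * bool)) : Prop :=
  reduced_form x s 1 /\
  match s with
  | [::] => False
  | (g1, e1) :: s' =>
      size s = 1%N \/
      (1 < size s)%N /\ ~~ pinch (last (g1, e1) s').2 g1 e1
  end.

Definition cyc_reduced (x : hnn) : Prop :=
  hnn_length x = 1%N \/ exists s, cyc_reduced_form x s.

(* For 1 <= r <= n, the cyclic conjugate starting with g_r t^{e_r}. *)
Definition cyc_conjugate (s : seq (A * bool)) (r : nat) : hnn :=
  hnn_eval (rot r.-1 s) 1.

End Hnn.

(* Main.v *)
Require Import Defs.
From mathcomp Require Import boolp classical_sets.
From mathcomp Require Import all_boot zify.

Set Implicit Arguments.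
Unset Strict Implicit.
Unset Printing Implicit Defensive.

Local Open Scope group_scope.

(** The theorem is a consequence of one invariant.  The group acts on the set of
normal forms a t^{e_1} r_1 ... t^{e_n} r_n, where r_i runs over chosen
representatives of the right cosets of C_{e_i}: the letters act by the rewriting
rules that left multiplication suggests, and [act_cong] says that the defining
relations hold for this action.  Hence the number of stable letters in the
normal form obtained from the empty one depends only on the group element
([syl_length]), and an induction along a reduced form shows that it is the
number of stable letters of that form ([syl_length_eval]).  This contains
Britton's lemma: an expression that has a stable letter but evaluates into A
contains a pinch.

For x = h v h^{-1} with v a cyclically reduced form and h a reduced form with
p > 0 stable letters, look at the two junctions of the word h v h^{-1}.  If
there is a pinch at one of them, then the first or the last syllable of v can be
moved across h; this rotates v and shortens h.  If there is none, then
h v h^{-1} and h v v h^{-1} are reduced, so that x has length 2p + |v| and x^2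
has length 2p + 2|v| (counting stable letters).  But lengths double on squares
of cyclically reduced elements, so p = 0, a contradiction.  Thus x is conjugate
by an element b of A to a rotation of v ([conj_cyclic]), which gives the equality
of lengths; comparing the last syllables of the two reduced forms of x b then
puts b in the right associated subgroup ([eq_cyclic_conj]).

When x and x' = h^{-1} x h both lie in A and h starts with g t^e, the word
h^{-1} x h must contain a pinch, and the only possible place is
t^{-e} (g^{-1} x g) t^e.  Removing it shortens h and produces the elements c_i
one pair at a time ([conj_base_pinch], [conj_base_chain]); in particular x is
conjugate to an element of an associated subgroup unless h lies in A. *)

Lemma conj_mulCl (G : groupType) (h w y z : G) : w = h * y ->
  h * (y * z) * h^-1 = w * (z * y) * w^-1.
Proof. by move=> ->; rewrite invgM !mulgA mulgK. Qed.

Lemma conj_mulCr (G : groupType) (h w y z : G) : h = w * z ->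
  h * (y * z) * h^-1 = w * (z * y) * w^-1.
Proof. by move=> ->; rewrite invgM !mulgA mulgK. Qed.

Section HnnTheory.
Variables (A : groupType) (D : hnn_datum A).

Notation C := (assoc D).
Notation emb := (hnn_emb D).
Notation tpow := (hnn_tpow D).
Notation eval := (hnn_eval D).
Notation syllables := (seq (A * bool)).

(** * Conjugation by the stable letter *)

Lemma tpowK e : tpow e * tpow (~~ e) = 1.
Proof. by case: e; rewrite /= ?mulgV ?mulVg. Qed.

Lemma tpowV e : (tpow e)^-1 = tpow (~~ e).
Proof. by case: e; rewrite /= ?invgK. Qed.

(** The isomorphism C_e -> C_{-e} induced by c |-> t^e c t^{-e}, that is phi or
its inverse; the default 1 of [xget] is returned only outside C_{+1}. *)
Definition assoc_iso (e : bool) (c : A) : A :=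
  if e then xget 1 [set b | b \in C false /\ c = phi D b] else phi D c.

Lemma assoc_iso_true c : c \in C true ->
  assoc_iso true c \in C false /\ phi D (assoc_iso true c) = c.
Proof.
move=> /phi_img[b Cb cE]; rewrite /assoc_iso.
set P := (X in xget 1 X); have [|iC <-] := @xgetPex _ 1 P; last by split.
by exists b.
Qed.

Lemma assoc_iso_in e c : c \in C e -> assoc_iso e c \in C (~~ e).
Proof.
case: e => Cc; first by case: (assoc_iso_true Cc).
by apply/phi_img; exists c.
Qed.

Lemma assoc_isoK e c : c \in C e -> assoc_iso (~~ e) (assoc_iso e c) = c.
Proof.
case: e => Cc; first by case: (assoc_iso_true Cc).
have [iC iE] := assoc_iso_true (assoc_iso_in Cc).
exact: phi_inj iC Cc iE.
Qed.

Lemma assoc_isoM e : {in C e &, {morph assoc_iso e : c d / c * d}}.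
Proof.
case: e => c d Cc Cd; last exact: phiM.
have [[c1 c2] [d1 d2]] := (assoc_iso_true Cc, assoc_iso_true Cd).
have [m1 m2] := assoc_iso_true (gpredM _ _ Cc Cd).
by apply: (@phi_inj _ D) => //; [rewrite gpredM | rewrite phiM // c2 d2].
Qed.

Lemma tpow_conj e c : c \in C e ->
  tpow e * emb c * tpow (~~ e) = emb (assoc_iso e c).
Proof.
case: e => Cc; last exact: hnn_conj_t.
have [iC {1}<-] := assoc_iso_true Cc.
by rewrite -hnn_conj_t // /= !mulgA mulgV mul1g mulgK.
Qed.

(** * Normal forms *)

Definition coset_rep (e : bool) (g : A) : A :=
  choose (fun y => y / g \in C e) g.

Lemma coset_repP e g : g / coset_rep e g \in C e.
Proof.
rewrite gpredFC; apply: (@chooseP _ (fun y => y / g \in C e)).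
by rewrite mulgV gpred1.
Qed.

Lemma coset_repM e c g : c \in C e -> coset_rep e (c * g) = coset_rep e g.
Proof.
move=> Cc; have E : (fun y => y / (c * g) \in C e) =1 (fun y => y / g \in C e).
  by move=> y; rewrite gpredFC -mulgA gpredMl // gpredFC.
rewrite /coset_rep (eq_choose E) //; apply: choose_id.
  by rewrite mulgK.
by rewrite mulgV gpred1.
Qed.

Lemma coset_rep_idem e g : coset_rep e (coset_rep e g) = coset_rep e g.
Proof.
by have <- := coset_repM (coset_rep e g) (coset_repP e g); rewrite mulgVK.
Qed.

(** The pair (a, [:: (e_1, r_1); ...; (e_n, r_n)]) stands for
a t^{e_1} r_1 ... t^{e_n} r_n.  Putting the free coefficient on the left makes
left multiplication by a letter a local operation. *)
Definition normal := (A * seq (bool * A))%type.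

Definition head_pinch (e : bool) (a : A) (l : seq (bool * A)) : bool :=
  if l is p :: _ then pinch D e a p.1 else false.

Fixpoint valid (l : seq (bool * A)) : bool :=
  if l is (e, r) :: l' then
    [&& coset_rep e r == r, ~~ head_pinch e r l' & valid l']
  else true.

Lemma head_pinchMl e c a l : c \in C e ->
  head_pinch e (c * a) l = head_pinch e a l.
Proof. by case: l => //= p l Cc; rewrite /pinch gpredMl. Qed.

(** In front of a t^{e_1} r_1 ..., the letter t^e either forms a pinch with
t^{e_1}, which is removed, or it lets the part of a in C_e pass to its left:
t^e (c r) = (t^e c t^{-e}) t^e r with r the representative of the coset of a. *)
Definition act_t (e : bool) (n : normal) : normal :=
  if head_pinch e n.1 n.2 then
    (assoc_iso e n.1 * (head (e, 1) n.2).2, behead n.2)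
  else
    (assoc_iso e (n.1 / coset_rep e n.1), (e, coset_rep e n.1) :: n.2).

Definition act_letter (x : A + bool) (n : normal) : normal :=
  match x with inl b => (b * n.1, n.2) | inr e => act_t e n end.

Definition act (u : seq (A + bool)) (n : normal) : normal :=
  foldr act_letter n u.

Lemma act_valid u n : valid n.2 -> valid (act u n).2.
Proof.
move=> vn; elim: u => [|[b|e] u] //=; case: (act u n) => a l /= vl.
rewrite /act_t /=; case: ifP => [|/negbT np] /=.
  by case: l vl => //= -[e' r] l /and3P[].
rewrite vl andbT coset_rep_idem eqxx.
by rewrite -(head_pinchMl (coset_rep e a) l (coset_repP e a)) mulgVK.
Qed.

(** This is the relation t^e c = (t^e c t^{-e}) t^e, valid on every normal form
because multiplying by c changes neither the coset of n.1 nor the presence of a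
pinch. *)
Lemma act_t_iso e c n : c \in C e ->
  act_t e (c * n.1, n.2) = act_letter (inl (assoc_iso e c)) (act_t e n).
Proof.
move=> Cc; case: n => a l; rewrite /act_t /= head_pinchMl //.
case: ifP => [|_] /=.
  by case: l => //= p l /andP[_ Ca]; rewrite assoc_isoM // mulgA.
by rewrite coset_repM // -mulgA (assoc_isoM Cc (coset_repP e a)).
Qed.

(** If t^e removes a pinch with (~~ e, r), then the validity of n forbids a pinch
when t^{-e} comes back, and the uniqueness of coset representatives restores r;
if t^e creates a syllable, then t^{-e} pinches with exactly that syllable. *)
Lemma act_tK e n : valid n.2 -> act_t (~~ e) (act_t e n) = n.
Proof.
case: n => a l /= vl; rewrite {2}/act_t /=; case: ifP => [|np].
  case: l vl => //= -[e' r] l /= /and3P[/eqP rE np _] /andP[/= /eqP e'E Ca].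
  move: rE np; rewrite e'E => rE np.
  have Ci := assoc_iso_in Ca.
  rewrite /act_t /= head_pinchMl // (negPf np) coset_repM // rE.
  by rewrite mulgK assoc_isoK.
have Cr := coset_repP e a.
by rewrite /act_t /= /pinch negbK eqxx assoc_iso_in //= assoc_isoK // mulgVK.
Qed.

Lemma act_cong u v : hnn_cong D u v ->
  forall n, valid n.2 -> act u n = act v n.
Proof.
elim=> {u v} //.
- by move=> u v _ IH n vn; rewrite IH.
- by move=> u v w _ IHu _ IHv n vn; rewrite IHu // IHv.
- move=> u u' v v' _ IHu _ IHv n vn.
  by rewrite /act !foldr_cat -!/(act _ _) IHv // IHu // act_valid.
- by move=> [a l] _; rewrite /= mul1g.
- by move=> a b [g l] _; rewrite /= mulgA.
- by move=> e n vn; rewrite /= -{1}[e]negbK act_tK.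
move=> c Cc n vn /=; have vt := act_valid [:: inr true] vn.
rewrite (act_t_iso (act_t true n) Cc).
by rewrite (act_tK true vn).
Qed.

Definition normal_form (x : hnn D) : normal := act (repr x) (1, [::]).

Lemma normal_form_pi u : normal_form (\pi_(hnn D)%qT u) = act u (1, [::]).
Proof. by apply: act_cong => //; exact: hnn_repr. Qed.

Lemma normal_form_embM b x :
  normal_form (emb b * x) = (b * (normal_form x).1, (normal_form x).2).
Proof. by rewrite -[x]reprK [emb b * _]hnn_pi_cat !normal_form_pi. Qed.

Lemma normal_form_tM e x : normal_form (tpow e * x) = act_t e (normal_form x).
Proof. by rewrite -hnn_pi_t -[x]reprK [_ * _]hnn_pi_cat !normal_form_pi. Qed.

Lemma normal_form1 : normal_form 1 = (1, [::]).
Proof. exact: normal_form_pi [::]. Qed.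

(** The number of stable letters; [hnn_lengthE] says that it is the length
minus one. *)
Definition syl_length (x : hnn D) : nat := size (normal_form x).2.

(** * Reduced forms *)

Lemma eval_nil a : eval [::] a = emb a.
Proof. by rewrite /hnn_eval big_nil mul1g. Qed.

Lemma eval_cons g e s a : eval ((g, e) :: s) a = emb g * (tpow e * eval s a).
Proof. by rewrite /hnn_eval big_cons /= !mulgA. Qed.

Lemma eval_cat s1 s2 a : eval (s1 ++ s2) a = eval s1 1 * eval s2 a.
Proof. by rewrite /hnn_eval big_cat /= gmulf1 mulg1 mulgA. Qed.

Lemma eval_embM s a b : eval s (a * b) = eval s a * emb b.
Proof. by rewrite /hnn_eval gmulfM mulgA. Qed.

Lemma eval_consM b g e s a :
  eval ((b * g, e) :: s) a = emb b * eval ((g, e) :: s) a.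
Proof. by rewrite !eval_cons gmulfM -mulgA. Qed.

Lemma eval_cons1 g e s : eval ((g, e) :: s) 1 = emb g * tpow e * eval s 1.
Proof. by rewrite eval_cons mulgA. Qed.

Lemma eval_rcons1 s g e :
  eval (rcons s (g, e)) 1 = eval s 1 * (emb g * tpow e).
Proof. by rewrite -cats1 eval_cat eval_cons eval_nil gmulf1 mulg1. Qed.

Lemma eval_pinch e g s a : g \in C e ->
  tpow e * eval ((g, ~~ e) :: s) a = emb (assoc_iso e g) * eval s a.
Proof.
by move=> Cg; rewrite eval_cons -tpow_conj // -!mulgA.
Qed.

Lemma eval_rcons s g e a :
  eval (rcons s (g, e)) a = eval s g * (tpow e * emb a).
Proof.
by rewrite -cats1 eval_cat eval_cons eval_nil mulgA -eval_embM mul1g.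
Qed.

Lemma reduced_cons g e s : reduced D ((g, e) :: s) =
  (if s is (g', e') :: _ then ~~ pinch D e g' e' else true) && reduced D s.
Proof. by case: s => [|[]]. Qed.

Lemma reduced_consM b g e s :
  reduced D ((b * g, e) :: s) = reduced D ((g, e) :: s).
Proof. by rewrite !reduced_cons. Qed.

(** No pinch ever occurs while a reduced form is built from its right end.  For
the induction one needs that the next letter would pinch with the normal form
exactly when it pinches with the form: their first coefficients differ by a
right factor in C_{-e'}, which membership in C_{-e'} does not see. *)
Lemma normal_form_eval s a : reduced D s ->
  size (normal_form (eval s a)).2 = size s /\
  forall e, head_pinch e (normal_form (eval s a)).1 (normal_form (eval s a)).2
    = if s is (g, e') :: _ then pinch D e g e' else false.
Proof.
elim: s => [_|[g e] s IH].
  by rewrite eval_nil -[emb a]mulg1 normal_form_embM normal_form1.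
rewrite reduced_cons => /andP[np /IH[sz hp]].
rewrite eval_cons normal_form_embM normal_form_tM /act_t hp.
have -> : (if s is (g', e') :: _ then pinch D e g' e' else false) = false.
  by case: s np {IH sz hp} => // -[g' e'] s /negPf.
split=> [|e0] /=; first by rewrite sz.
rewrite /pinch; case: eqVneq => //= eE; rewrite gpredMr //.
rewrite -[e0]negbK -eE; exact/assoc_iso_in/coset_repP.
Qed.

Lemma syl_length_eval s a : reduced D s -> syl_length (eval s a) = size s.
Proof. by move=> /(normal_form_eval a)[]. Qed.

Lemma reduced_behead p s : reduced D (p :: s) -> reduced D s.
Proof. exact: path_sorted. Qed.

Lemma reduced_formP (x : hnn D) : exists s a, reduced_form x s a.
Proof.
rewrite -[x]reprK; elim: (repr x) => [|l u [s [a [rs E]]]].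
  by exists [::], 1; split => //; rewrite eval_nil gmulf1.
have -> : \pi_(hnn D)%qT (l :: u) = \pi_(hnn D)%qT [:: l] * \pi_(hnn D)%qT u.
  by rewrite [RHS]hnn_pi_cat.
rewrite {}E; case: l => [b|e].
  case: s rs => [|[g e] s] rs.
    by exists [::], (b * a); split=> //; rewrite !eval_nil gmulfM.
  by exists ((b * g, e) :: s), a; rewrite /reduced_form reduced_consM eval_consM.
rewrite hnn_pi_t.
have push : (if s is (g, e') :: _ then ~~ pinch D e g e' else true) ->
    exists s' a', reduced_form (tpow e * eval s a) s' a'.
  move=> np; exists ((1, e) :: s), a; split; first by rewrite reduced_cons np.
  by rewrite eval_cons gmulf1 mul1g.
case: s rs push => [|[g e'] s] rs; first exact.
case: (boolP (pinch D e g e')) => [/andP[/eqP -> Cg] _ | _]; last exact.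
rewrite eval_pinch //; move: rs => /reduced_behead; case: s => [|[g' e''] s] rs.
  by exists [::], (assoc_iso e g * a); split=> //; rewrite !eval_nil gmulfM.
exists ((assoc_iso e g * g', e'') :: s), a.
by rewrite /reduced_form reduced_consM eval_consM.
Qed.

Lemma hnn_lengthE (x : hnn D) : hnn_length x = (syl_length x).+1.
Proof.
rewrite /hnn_length; congr _.+1; set P := (X in xget _ X).
have [|rs ->] := @xgetPex _ ([::], 1) P; last by rewrite syl_length_eval.
by have [s [a sa]] := reduced_formP x; exists (s, a).
Qed.

Lemma in_baseP (x : hnn D) : in_base x <-> syl_length x = 0%N.
Proof.
split=> [[a ->]|]; first by rewrite -eval_nil syl_length_eval.
have [s [a [rs ->]]] := reduced_formP x; rewrite syl_length_eval //.
by case: s rs => // _ _; exists a; rewrite eval_nil.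
Qed.

Lemma reduced_cat s1 p q s2 : reduced D (rcons s1 p ++ q :: s2) =
  [&& reduced D (rcons s1 p), ~~ pinch D p.2 q.1 q.2 & reduced D (q :: s2)].
Proof.
rewrite /reduced sorted_cat_cons -[rcons (rcons _ _) _]cats1 cat_rcons.
by rewrite sorted_cat_cons /= andbT -andbA.
Qed.

Lemma evalE s a : eval s a = eval s 1 * emb a.
Proof. by rewrite -eval_embM mul1g. Qed.

(** The form a^{-1} t^{-e_n} g_n^{-1} ... t^{-e_1} g_1^{-1} of the inverse of
g_1 t^{e_1} ... g_n t^{e_n} a. *)
Fixpoint inv_form (s : syllables) (a : A) : syllables * A :=
  if s is (g, e) :: s' then
    (rcons (inv_form s' a).1 ((inv_form s' a).2, ~~ e), g^-1)
  else ([::], a^-1).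

Lemma eval_inv_form s a :
  eval (inv_form s a).1 (inv_form s a).2 = (eval s a)^-1.
Proof.
elim: s => [|[g e] s IH] /=; first by rewrite !eval_nil gmulfV.
rewrite eval_rcons eval_cons IH; move: (eval s a) => y.
by rewrite !invgM tpowV gmulfV mulgA.
Qed.

Lemma size_inv_form s a : size (inv_form s a).1 = size s.
Proof. by elim: s => [|[g e] s IH] //=; rewrite size_rcons IH. Qed.

Lemma pinchV e a e' : pinch D (~~ e') a^-1 (~~ e) = pinch D e a e'.
Proof. by rewrite /pinch gpredV; case: e e' => [] []. Qed.

Lemma reduced_inv_form s a : reduced D s -> reduced D (inv_form s a).1.
Proof.
elim: s => [|[g e] [|[g' e'] s] IH] //.
rewrite reduced_cons => /andP[np /IH /=]; set r := rcons _ _ => rr.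
by rewrite -[rcons r _]cats1 reduced_cat rr /= andbT pinchV.
Qed.

Lemma inv_form_rcons s g e a :
  exists r, (inv_form (rcons s (g, e)) a).1 = (a^-1, ~~ e) :: r.
Proof.
elim: s => [|[g' e'] s [r /= ->]] /=; first by exists [::].
by eexists.
Qed.

Lemma last_sign b g e (s : syllables) :
  (last (b * g, e) s).2 = (last (g, e) s).2.
Proof. by case: s. Qed.

(** * Conjugation of cyclically reduced elements *)

Notation pinch_free := (fun p q : A * bool => ~~ pinch D p.2 q.1 q.2).

(** A form with a single syllable needs no separate treatment: t^e g t^e is
never a pinch, so cyclic reducedness is the absence of pinches around the
cycle. *)
Lemma cyc_reduced_formE (x : hnn D) s : cyc_reduced_form x s <->
  [/\ s != [::], cycle pinch_free s & x = eval s 1].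
Proof.
case: s => [|[g e] s]; first by split=> [[]|[]].
rewrite /= rcons_path /=; split=> [[[rs ->] H]|[_ /andP[rs H] ->]].
  split=> //; rewrite -/(path pinch_free (g, e) s) [path _ _ _]rs /=.
  case: H => [/= [/size0nil ->]|[_ //]] /=.
  by rewrite /pinch; case: (e).
split=> //; case: s H {rs} => [|p s] H; [by left | by right].
Qed.

(** The last two hypotheses say that there is no pinch at the two junctions of
h v h^{-1}, so this word is reduced as it stands. *)
Lemma syl_length_conj s g e a v1 n v :
  reduced D (rcons s (g, e)) -> reduced D ((v1, n) :: v) ->
  ~~ pinch D e (a * v1) n -> ~~ pinch D (last (v1, n) v).2 a^-1 (~~ e) ->
  syl_length (eval (rcons s (g, e)) a * eval ((v1, n) :: v) 1 *
              (eval (rcons s (g, e)) a)^-1) = ((size s).+1.*2 + (size v).+1)%N.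
Proof.
move=> rs rv np1 np2; set h := eval (rcons _ _) _.
have := eval_inv_form (rcons s (g, e)) a.
have := reduced_inv_form a rs; have := size_inv_form (rcons s (g, e)) a.
have [r ->] := inv_form_rcons s g e a; move: (inv_form _ _).2 => b.
rewrite size_rcons /= => -[sz] rr; rewrite -/h => <-.
have -> : h * eval ((v1, n) :: v) 1 * eval ((a^-1, ~~ e) :: r) b =
    eval (rcons s (g, e) ++ ((a * v1, n) :: v) ++ (a^-1, ~~ e) :: r) b.
  by rewrite {}/h evalE eval_cat evalE eval_cat eval_consM !gmulf1 !mulg1
    -!mulgA.
rewrite syl_length_eval.
  by rewrite !size_cat size_rcons /= sz addnCA addnn addnC.
rewrite cat_cons reduced_cat -cat_cons rs np1 [X in X ++ _]lastI reduced_cat.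
by rewrite -lastI reduced_consM rv last_sign np2.
Qed.

Lemma cycle_reduced v : cycle pinch_free v -> reduced D v.
Proof. by case: v => //= p v; rewrite rcons_path => /andP[]. Qed.

Lemma cycle_double v : cycle pinch_free v -> reduced D (v ++ v).
Proof.
case: v => //= p v; rewrite rcons_path => /andP[pv np].
by rewrite /reduced /= cat_path pv /= np.
Qed.

Lemma rot_rot_ex T (m n : nat) (s : seq T) : exists k, rot m (rot n s) = rot k s.
Proof.
case: (leqP n (size s)) => [ns|/ltnW/rot_oversize ->]; last by exists m.
case: (leqP m (size s)) => [ms|ms]; first by rewrite rot_add_mod //; eexists.
by exists n; rewrite rot_oversize // size_rot ltnW.
Qed.

Lemma syl_length_conj_emb b s a : reduced D s ->
  syl_length (emb b * eval s 1 * emb a) = size s.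
Proof.
rewrite -mulgA -evalE; case: s => [|[g e] s] rs.
  by apply/in_baseP; exists (b * a); rewrite eval_nil gmulfM.
by rewrite -eval_consM syl_length_eval // reduced_consM.
Qed.

Lemma cyc_reduced_sqr (x : hnn D) : cyc_reduced x ->
  syl_length (x * x) = (syl_length x).*2.
Proof.
case=> [|[s /cyc_reduced_formE[_ cs ->]]].
  rewrite hnn_lengthE => -[x0]; rewrite x0.
  have /in_baseP[b ->] := x0; rewrite -gmulfM.
  by apply/in_baseP; exists (b * b).
rewrite -eval_cat !syl_length_eval ?cycle_double ?cycle_reduced //.
by rewrite size_cat addnn.
Qed.

(** Induction on the number of stable letters of the conjugator h: a pinch at
either junction of h v h^{-1} rotates v and shortens h, and if there is no pinch
then the lengths of x and x^2 are incompatible with the doubling hypothesis. *)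
Lemma conj_cyclic s a v x :
    reduced D s -> v != [::] -> cycle pinch_free v ->
    syl_length (x * x) = (syl_length x).*2 ->
    x = eval s a * eval v 1 * (eval s a)^-1 ->
  exists k b, x = emb b * eval (rot k v) 1 * (emb b)^-1.
Proof.
elim/last_ind: s a v => [|s [g e] IH] a v rs v0 cv xx xE.
  by exists 0%N, a; rewrite rot0 -eval_nil.
have rs' : reduced D s by move: rs; rewrite -cats1 => /cat_sorted2[].
have rotate k0 b : x = eval s b * eval (rot k0 v) 1 * (eval s b)^-1 ->
    exists k b, x = emb b * eval (rot k v) 1 * (emb b)^-1.
  move=> E; have [||k [c cE]] := IH b (rot k0 v) rs' _ _ xx E.
  - by rewrite -size_eq0 size_rot size_eq0.
  - by rewrite rot_cycle.
  by have [k' kE] := rot_rot_ex k k0 v; exists k', c; rewrite -kE.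
case: v v0 cv xE rotate => // -[v1 n1] v _ cv xE rotate.
case: (boolP (pinch D e (a * v1) n1)) => [/andP[/eqP nE Cav]|np1].
  (* t^e a v1 t^{-e} is a pinch: h v1 t^{-e} is a shorter conjugator. *)
  apply: (rotate 1%N (g * assoc_iso e (a * v1))).
  rewrite xE rot1_cons eval_cons1 eval_rcons1; apply: conj_mulCl.
  rewrite eval_embM -tpow_conj // gmulfM eval_rcons nE.
  by move: (eval s g) => y; rewrite !mulgA.
case: (boolP (pinch D (last (v1, n1) v).2 a^-1 (~~ e))) => [|np2].
  move: xE rotate; rewrite lastI; move: (belast _ _) (last _ _) => w [vm nm].
  move=> xE rotate /andP[/eqP/negb_inj/= nE]; rewrite gpredV.
  rewrite -{}nE in xE rotate * => Ca.
  (* t^e a^{-1} t^{-e} is a pinch: h (vm t^e)^{-1} is a shorter conjugator. *)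
  apply: (rotate (size w) (g * assoc_iso e a * vm^-1)).
  rewrite xE -[in rot _ _]cats1 rot_size_cat eval_rcons1 eval_cons1; apply: conj_mulCr.
  rewrite !eval_embM -tpow_conj // eval_rcons.
  move: (eval s g) => y; rewrite gmulfV !mulgA mulgVK -{4}[e]negbK.
  by rewrite -(mulgA _ (tpow (~~ e))) tpowK mulg1.
(* No pinch: compare the lengths of h v h^{-1} and h v v h^{-1}. *)
have := syl_length_conj rs (cycle_reduced cv) np1 np2; rewrite -xE => xl.
have cvv := cycle_double cv.
have := @syl_length_conj s g e a v1 n1 (v ++ (v1, n1) :: v) rs cvv np1.
rewrite last_cat /= => /(_ np2).
have -> : eval ((v1, n1) :: v ++ (v1, n1) :: v) 1
  = eval ((v1, n1) :: v) 1 * eval ((v1, n1) :: v) 1 by rewrite -eval_cat.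
have -> : forall y k : hnn D, k * (y * y) * k^-1 = k * y * k^-1 * (k * y * k^-1).
  by move=> y k; rewrite !mulgA mulgVK.
rewrite -xE xx xl size_cat /=; lia.
Qed.

(** Both elements play the same role, so it is enough to treat the case where
the conjugated one has a cyclically reduced form; if neither has one, both lie
in A. *)
Lemma conj_syl_length (x x' h : hnn D) : cyc_reduced x -> cyc_reduced x' ->
  x = h * x' * h^-1 -> syl_length x = syl_length x'.
Proof.
have half (y y' k : hnn D) s : cyc_reduced y -> cyc_reduced_form y' s ->
    y = k * y' * k^-1 -> syl_length y = syl_length y'.
  move=> /cyc_reduced_sqr yy /cyc_reduced_formE[s0 cs ->].
  have [r [a [rr ->]]] := reduced_formP k.
  move=> /(conj_cyclic rr s0 cs yy)[i [b ->]].
  rewrite -gmulfV syl_length_conj_emb ?cycle_reduced ?rot_cycle //.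
  by rewrite size_rot syl_length_eval // cycle_reduced.
move=> cx cx' xE; case: (cx') => [x'0|[s sx']]; last exact: half sx' xE.
case: (cx) => [x0|[s sx]]; first by apply: succn_inj; rewrite -!hnn_lengthE x0.
apply/esym/(half _ _ h^-1 _ cx' sx); by rewrite xE invgK !mulgA mulgVK mulVg mul1g.
Qed.

(** Multiplying the first form by the inverse of the second gives a word for 1
whose only possible pinch is at the junction t^e (a / a') t^{-e'}. *)
Lemma eq_reduced_last s g e a s' g' e' a' :
  reduced D (rcons s (g, e)) -> reduced D (rcons s' (g', e')) ->
  eval (rcons s (g, e)) a = eval (rcons s' (g', e')) a' ->
  e = e' /\ a / a' \in C e.
Proof.
move=> rs rs' E; have := eval_inv_form (rcons s' (g', e')) a'.
have := reduced_inv_form a' rs'; have [r ->] := inv_form_rcons s' g' e' a'.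
move: (inv_form _ _).2 => b rr rE.
have E1 : eval (rcons s (g, e) ++ (a * a'^-1, ~~ e') :: r) b = 1.
  by rewrite eval_cat eval_consM mulgA -evalE rE E mulgV.
case: (boolP (pinch D e (a / a') (~~ e'))) => [/andP[/eqP/negb_inj -> //]|np].
have := @syl_length_eval (rcons s (g, e) ++ (a / a', ~~ e') :: r) b.
rewrite reduced_cat rs np reduced_consM rr E1 => /(_ isT).
by rewrite /syl_length normal_form1 size_cat size_rcons.
Qed.

(** * Conjugation of elements of the base group *)

(** The word h^{-1} b h evaluates to b', hence it is not reduced, and its only
possible pinch is t^{-e} (g^{-1} b g) t^e. *)
Lemma conj_base_pinch g e s a b b' : reduced D ((g, e) :: s) ->
  let h := eval ((g, e) :: s) a in emb b = h * emb b' * h^-1 ->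
  exists2 d, d \in C (~~ e) &
    [/\ emb b = emb g * emb d * (emb g)^-1,
        emb d = tpow e * emb (assoc_iso (~~ e) d) * tpow (~~ e)
      & emb (assoc_iso (~~ e) d) = eval s a * emb b' * (eval s a)^-1].
Proof.
move=> rs h bE; set d := g^-1 * (b * g).
have dE : emb b = emb g * emb d * (emb g)^-1.
  by rewrite -!gmulfV -!gmulfM /d !mulgA mulgV mul1g mulgK.
have Cd : d \in C (~~ e).
  have hV := eval_inv_form ((g, e) :: s) a.
  have rV := reduced_inv_form a rs.
  set t := inv_form s a; rewrite /= -/t in hV rV.
  case: (boolP (pinch D (~~ e) d e)) => [/andP[] //|np].
  have := @syl_length_eval (rcons t.1 (t.2, ~~ e) ++ (d, e) :: s) a.
  rewrite reduced_cat rV np.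
  have -> : eval (rcons t.1 (t.2, ~~ e) ++ (d, e) :: s) a = emb b'.
    rewrite eval_cat eval_consM mulgA -evalE hV eval_consM bE -/h.
    by move: (h) => y; rewrite !mulgA mulVg mul1g mulgVK.
  have -> : reduced D ((d, e) :: s) by rewrite /d !reduced_consM.
  move=> /(_ isT); have -> : syl_length (emb b') = 0%N.
    by apply/in_baseP; exists b'.
  by rewrite size_cat size_rcons.
exists d => //.
have tE : emb d = tpow e * emb (assoc_iso (~~ e) d) * tpow (~~ e).
  by rewrite -tpow_conj // negbK !mulgA tpowK mul1g -mulgA tpowK mulg1.
(* Both sides of the last equation agree after conjugation by g t^e. *)
split=> //; apply: (mulgI (tpow e)); apply: (mulIg (tpow (~~ e))).
rewrite -tE; apply: (mulgI (emb g)); apply: (mulIg (emb g)^-1).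
rewrite -dE bE /h eval_cons; move: (eval s a) => y.
by rewrite !invgM tpowV !mulgA.
Qed.

(** Each stable letter of h, read from the left, contributes the pair
(g^{-1} b g, t^{-e} (g^{-1} b g) t^e), and the second element takes the place
of b for the rest of h. *)
Lemma conj_base_chain s a b b' : reduced D s ->
  emb b = eval s a * emb b' * (eval s a)^-1 ->
  let p := size s in
  let hs := nth 1 (rcons (unzip1 s) a) in
  let es := nth true (unzip2 s) in
  exists c : nat -> A,
    [/\ forall i, (i < p.*2)%N -> (c i \in C true) || (c i \in C false),
        emb (c p.*2) = emb b',
        emb b = emb (hs 0%N) * emb (c 0%N) * (emb (hs 0%N))^-1
      & forall i, (i < p)%N ->
          emb (c i.*2.+1) =
            emb (hs i.+1) * emb (c i.*2.+2) * (emb (hs i.+1))^-1 /\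
          emb (c i.*2) = tpow (es i) * emb (c i.*2.+1) * tpow (~~ es i)].
Proof.
elim: s b => [|[g e] s IH] b rs bE.
  by exists (fun=> b'); split=> //=; rewrite bE eval_nil.
have [d Cd [-> dE yE]] := conj_base_pinch rs bE.
have [c [cC cl c0 cS]] := IH _ (reduced_behead rs) yE.
have CC f k : k \in C f -> (k \in C true) || (k \in C false).
  by case: f => ->; rewrite ?orbT.
exists (fun i => match i with
  0 => d | 1 => assoc_iso (~~ e) d | j.+2 => c j end); split=> //.
- move=> [|[|i]] //= ip; first exact: CC Cd.
    exact/CC/assoc_iso_in/Cd.
  by apply: cC; move: ip; rewrite doubleS !ltnS.
- by move=> [|i] ip //=; apply: cS.
Qed.

(** * The conjugacy theorem *)

(** The reduced forms u b and b (rot k v) of the same element x b end with b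
and with 1, so b lies in the subgroup attached to the last sign of u. *)
Lemma eq_cyclic_conj (x : hnn D) u v k b :
  cyc_reduced_form x u -> v != [::] -> cycle pinch_free v ->
  x = emb b * eval (rot k v) 1 * (emb b)^-1 ->
  b \in C (nth true (unzip2 u) (size u).-1).
Proof.
move=> /cyc_reduced_formE[u0 /cycle_reduced ru ->] v0 cv E.
case/lastP: u u0 ru E => // u [g e] _ ru E.
have -> : nth true (unzip2 (rcons u (g, e))) (size (rcons u (g, e))).-1 = e.
  by rewrite /unzip2 map_rcons size_rcons nth_rcons size_map ltnn eqxx.
have rw : reduced D (rot k v) by rewrite cycle_reduced ?rot_cycle.
have : rot k v != [::] by rewrite -size_eq0 size_rot size_eq0.
case: (rot k v) rw E => // -[g1 e1] w rw E _.
have : eval (rcons u (g, e)) b = eval ((b * g1, e1) :: w) 1.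
  by rewrite evalE E mulgVK eval_consM.
have : reduced D ((b * g1, e1) :: w) by rewrite reduced_consM.
rewrite lastI; move: (belast _ _) (last _ _) => w' [g2 e2] rw' E'.
by have [_] := eq_reduced_last ru rw' E'; rewrite invg1 mulg1.
Qed.

End HnnTheory.

Theorem mainTheorem4 (A : groupType) (D : hnn_datum A) (x x' h : hnn D)
    (hx : cyc_reduced x) (hx' : cyc_reduced x') (hconj : x = h * x' * h^-1) :
  hnn_length x = hnn_length x' /\
  [/\ (* (i) *)
      conj_to_assoc x ->
        [/\ in_base x, in_base x' &
          forall (s : seq (A * bool)) (a : A), reduced_form h s a ->
            let p := size s in
            (* hs i and es i are h_{i+1} and the sign e_{i+1} *)
            let hs := nth 1 (rcons (unzip1 s) a) in
            let es := nth true (unzip2 s) in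
            exists c : nat -> A,
              [/\ forall i, (i < p.*2)%N ->
                    (c i \in assoc D true) || (c i \in assoc D false),
                  hnn_emb D (c p.*2) = x',
                  x = hnn_emb D (hs 0%N) * hnn_emb D (c 0%N)
                        * (hnn_emb D (hs 0%N))^-1
                & forall i, (i < p)%N ->
                    hnn_emb D (c i.*2.+1) =
                      hnn_emb D (hs i.+1) * hnn_emb D (c i.*2.+2)
                        * (hnn_emb D (hs i.+1))^-1 /\
                    hnn_emb D (c i.*2) =
                      hnn_tpow D (es i) * hnn_emb D (c i.*2.+1)
                        * hnn_tpow D (~~ es i)]],
      (* (ii) *)
      in_base x -> ~ conj_to_assoc x -> in_base x' /\ in_base h
    & (* (iii) *)
      ~ in_base x ->
        forall (m : nat) (u v : seq (A * bool)),
          (1 <= m)%N -> size u = m -> size v = m ->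
          cyc_reduced_form x u -> cyc_reduced_form x' v ->
          exists (r : nat) (alpha : A),
            [/\ (1 <= r <= m)%N,
                alpha \in assoc D (nth true (unzip2 u) m.-1)
              & x = hnn_emb D alpha * cyc_conjugate D v r
                      * (hnn_emb D alpha)^-1]].
Proof.
have lE := conj_syl_length hx hx' hconj.
have base : in_base x -> in_base x' by rewrite !in_baseP lE.
split; first by rewrite !hnn_lengthE lE.
have baseP b b' : x = hnn_emb D b -> x' = hnn_emb D b' ->
  hnn_emb D b = h * hnn_emb D b' * h^-1 by move=> <- <-.
split.
- move=> [k [e [c [Cc xE]]]].
  have bx : in_base x.
    apply/in_baseP; have -> : syl_length x = syl_length (hnn_emb D c).
      apply: (conj_syl_length hx _ xE); left; rewrite hnn_lengthE; congr _.+1.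
      by apply/in_baseP; exists c.
    by apply/in_baseP; exists c.
  have bx' := base bx; split=> // s a [rs hE].
  have [[b bE] [b' bE']] := (bx, bx').
  have := baseP _ _ bE bE'; rewrite hE => /(conj_base_chain rs).
  by rewrite -bE -bE'.
- move=> bx nc; have bx' := base bx; split=> //.
  have [s [a [rs hE]]] := reduced_formP h.
  have [[b bE] [b' bE']] := (bx, bx').
  case: s rs hE => [|[g e] s] rs hE; first by exists a; rewrite hE eval_nil.
  have := baseP _ _ bE bE'; rewrite hE => /(conj_base_pinch rs)[d Cd [dE _ _]].
  by case: nc; exists (hnn_emb D g), (~~ e), d; rewrite bE dE.
move=> _ m u v m0 um vm xu /cyc_reduced_formE[v0 cv vE].
have [s [a [rs hE]]] := reduced_formP h.
have xE : x = hnn_eval D s a * hnn_eval D v 1 * (hnn_eval D s a)^-1.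
  by rewrite -hE -vE.
have [k [b kE]] := conj_cyclic rs v0 cv (cyc_reduced_sqr hx) xE.
have [r rm rE] : exists2 r, (r < m)%N & rot k v = rot r v.
  case: (ltnP k m) => [km|mk]; first by exists k.
  by exists 0%N => //; rewrite rot_oversize ?vm // rot0.
exists r.+1, b; split=> //; first by rewrite -um; apply: eq_cyclic_conj kE.
by rewrite kE rE.
Qed.
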